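(* Let $p\ge m\ge 0$ be integers and let $X=\{\vec x_1,\dots,\vec x_N\}\subset[0,1]^3$ be distinct nodes, unisolvent with respect to the polynomials of total degree at most $p$ on $\mathbb{R}^3$. Let $K(\cdot,\cdot)$ be a symmetric kernel on $\mathbb{R}^3$ that is strictly conditionally positive (or negative) definite of degree $m$, and let $d\in\mathbb{R}^N$. Let $K\in\mathbb{R}^{N\times N}$ also denote the matrix $K_{i,j}=K(\vec x_i,\vec x_j)$, and suppose that $u\in\mathbb{R}^N$, with $u\perp\mathcal{P}^m(X)$, uniquely solves (together with some $c\in\mathbb{R}^{M(m)}$) the RBF interpolation problem $$\begin{pmatrix} K & Q \\ Q^{T} & 0 \end{pmatrix} \begin{pmatrix} u \\ c \end{pmatrix} = \begin{pmatrix} d \\ 0 \end{pmatrix}.$$ Let $T$ be the matrix whose columns are all the vectors of the sets $\bar D^j_k$, $j=0,\dots,n$, $k\in\mathcal{K}(j)$, and let $C_\perp$ be the matrix whose columns are the vectors of $\bar D^{-1}_0$, in the adapted discrete hierarchical basis of degree $p$ (coarse degree $m$) for $X$. Put $M=\dim\mathcal{P}^p(X)$ and $O=\dim\mathcal{P}^m(X)$. Then there exist $s\in\mathbb{R}^{M-O}$ and $w\in\mathbb{R}^{N-M}$ such that $$\begin{pmatrix} C_\perp^{T}KC_\perp & C_\perp^{T}KT \\ {T}^{T}KC_\perp & {T}^{T}KT \end{pmatrix} \begin{pmatrix} s \\ {w} \end{pmatrix} = \begin{pmatrix} C_\perp^{T}d \\ {T}^{T}d \end{pmatrix},$$ and moreover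 $u=C_\perp s+Tw$. (Here $A^T$ is the transpose of $A$.)
   Context: Notation: for $d'\ge0$, $M(d')=\binom{d'+3}{3}$; $\mathcal{P}^{d'}(X)\subset\mathbb{R}^N$ is the space of vectors $(q(\vec x_1),\dots,q(\vec x_N))$ with $q$ a polynomial in three variables of total degree at most $d'$. $Q_{d'}$ is the matrix with entries $q_j(\vec x_i)$ for a basis $q_1,\dots,q_{M(d')}$ of the polynomials of total degree at most $d'$, and $Q=Q_m$. $X$ is unisolvent for degree $p$ if only the zero polynomial of degree at most $p$ vanishes on $X$. $e_i$ is the $i$-th standard unit vector of $\mathbb{R}^N$, associated with node $\vec x_i$. A symmetric function $K:\mathbb{R}^3\times\mathbb{R}^3\to\mathbb{R}$ is strictly conditionally positive definite of degree $l$ if for every finite set $Y=\{\vec y_1,\dots,\vec y_r\}\subset\mathbb{R}^3$ of distinct points, $\sum_{i,j}v_iv_jK(\vec y_i,\vec y_j)>0$ for all nonzero $v\in\mathbb{R}^r$ with $v\perp\mathcal{P}^l(Y)$; strictly conditionally negative definite if the sum is always $<0$ instead. Tree of cubes: start with $B^0_0=[0,1]^3$ at level $0$; a cube at level $j$ containing more than $M(p)$ nodes is partitioned into eight congruent subcubes at level $j+1$ (each node is assigned to exactly one of them), the nonempty ones being its children. The procedure stops when every cube that has not been subdivided contains at most $M(p)$ nodes; $n$ is the largest level reached and $\mathcal{K}(j)$ indexes the nonempty cubes $B^j_k$ of level $j$. Decomposition of degree $d'$: given orthonormal vectors $v_1,\dots,v_s\in\mathbb{R}^N$, put $V=[v_1,\dots,v_s]$,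 $M_{s,d'}=Q_{d'}^{T}V$, $a=\mathrm{rank}\,M_{s,d'}$, and take a full set of right singular vectors of $M_{s,d'}$, i.e. an orthonormal basis $g_1,\dots,g_s$ of $\mathbb{R}^s$ in which $g_{a+1},\dots,g_s$ is an orthonormal basis of the null space of $M_{s,d'}$. Set $\phi_l=Vg_l$ for $1\le l\le a$ (average vectors) and $\psi_l=Vg_l$ for $a+1\le l\le s$ (detail vectors). Adapted discrete hierarchical basis: proceed from level $n$ down to level $0$. For each nonempty cube $B^j_k$, let $\mathbf{B}^j_k=\{e_i:\vec x_i\in B^j_k\}$ if $B^j_k$ has no children, and let $\mathbf{B}^j_k$ be the union of the sets $\bar C^{j+1}_l$ over the children $B^{j+1}_l$ of $B^j_k$ otherwise. Apply the decomposition of degree $p$ to $\mathbf{B}^j_k$; $\bar C^j_k$ is the resulting set of average vectors and $\bar D^j_k$ the resulting set of detail vectors. Finally apply the decomposition of degree $m$ to $\bar C^0_0$; $\bar C^{-1}_0$ and $\bar D^{-1}_0$ are the resulting sets of average and detail vectors respectively. *)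

(* Defs.v *)
(* The field of real numbers is an arbitrary [R : realType]. *)
From mathcomp Require Import all_boot all_order all_algebra.
From mathcomp Require Import reals.
From mathcomp Require Import mpoly.

Set Implicit Arguments.
Unset Strict Implicit.
Unset Printing Implicit Defensive.

Import Order.TTheory GRing.Theory Num.Theory.
Local Open Scope ring_scope.

Section Polynomials.
Context {R : realType}.

Definition Mdim (d : nat) : nat := 'C(d + 3, 3).

(* [msize f] is one more than the total degree, and [msize 0 = 0]. *)
Definition tdeg_le (d : nat) (f : {mpoly R[3]}) : bool := (msize f <= d.+1)%N.

Definition poly_basis (d : nat) (q : 'I_(Mdim d) -> {mpoly R[3]}) : Prop :=
  [/\ forall l, tdeg_le d (q l),
      forall c : 'I_(Mdim d) -> R,
        \sum_l c l *: q l = 0 -> forall l, c l = 0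
    & forall f, tdeg_le d f ->
        exists c : 'I_(Mdim d) -> R, f = \sum_l c l *: q l].

Definition evalv (r : nat) (X : 'I_r -> 'rV[R]_3) (f : {mpoly R[3]}) :
  'cV[R]_r := \col_i f.@[X i 0].

(* The monomials of degree at most [d] give a finite spanning family; see
   [polyspaceP] for membership in terms of polynomials. *)
Definition polyspace (d r : nat) (X : 'I_r -> 'rV[R]_3) : {vspace 'cV[R]_r} :=
  <<[seq evalv X 'X_[bmnm a] | a : 'X_{1..3 < d.+1}]>>%VS.

Lemma polyspaceP (d r : nat) (X : 'I_r -> 'rV[R]_3) (v : 'cV[R]_r) :
  v \in polyspace d X <-> exists2 f, tdeg_le d f & v = evalv X f.
Proof.
split=> [|[f df ->]].
  move=> /(@coord_span _ _ _ (in_tuple _)) ->.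
  apply: (big_ind (fun w => exists2 f, tdeg_le d f & w = evalv X f)).
  - exists 0; first by rewrite /tdeg_le msize0.
    by apply/colP => i; rewrite !mxE meval0.
  - move=> _ _ [f df ->] [g dg ->]; exists (f + g).
      by apply: leq_trans (msizeD_le _ _) _; rewrite geq_max; apply/andP.
    by apply/colP => i; rewrite !mxE mevalD.
  move=> k _; move: (coord _ _ _) => c; move: k => -[k /= lt_k].
  have /mapP[a _ ->] := mem_nth 0 lt_k.
  exists (c *: 'X_[bmnm a]).
    apply: leq_trans (msizeZ_le _ _) _.
    by rewrite msizeX bmdeg.
  by apply/colP => i; rewrite !mxE mevalZ.
have -> : evalv X f =
    \sum_(a : 'X_{1..3 < d.+1}) f@_a *: evalv X 'X_[bmnm a].
  apply/colP => i; rewrite mxE {1}(mpolywE df) summxE raddf_sum /=.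
  by apply: eq_bigr => a _; rewrite !mxE mevalZ.
apply: rpred_sum => a _; apply: rpredZ; apply: memv_span.
by apply/mapP; exists a; rewrite ?mem_enum.
Qed.

Definition polymx (r d : nat) (X : 'I_r -> 'rV[R]_3)
    (q : 'I_(Mdim d) -> {mpoly R[3]}) : 'M[R]_(r, Mdim d) :=
  \matrix_(i, l) (q l).@[X i 0].

Definition unisolvent (p r : nat) (X : 'I_r -> 'rV[R]_3) : Prop :=
  forall f, tdeg_le p f -> (forall i, f.@[X i 0] = 0) -> f = 0.

Definition orthogonal_to (r : nat) (v : 'cV[R]_r) (U : {vspace 'cV[R]_r}) :=
  forall w, w \in U -> \sum_i v i 0 * w i 0 = 0.

End Polynomials.

Section Kernels.
Context {R : realType}.
Implicit Type K : 'rV[R]_3 -> 'rV[R]_3 -> R.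

Definition quadform K (r : nat) (y : 'I_r -> 'rV[R]_3) (v : 'cV[R]_r) : R :=
  \sum_i \sum_j v i 0 * v j 0 * K (y i) (y j).

Definition symmetric_kernel K : Prop := forall x y, K x y = K y x.

Definition scpd (l : nat) K : Prop :=
  symmetric_kernel K /\
  forall (r : nat) (y : 'I_r -> 'rV[R]_3), injective y ->
  forall v : 'cV[R]_r, v != 0 -> orthogonal_to v (polyspace l y) ->
    0 < quadform K y v.

Definition scnd (l : nat) K : Prop :=
  symmetric_kernel K /\
  forall (r : nat) (y : 'I_r -> 'rV[R]_3), injective y ->
  forall v : 'cV[R]_r, v != 0 -> orthogonal_to v (polyspace l y) ->
    quadform K y v < 0.

Definition kermatrix K (r : nat) (X : 'I_r -> 'rV[R]_3) : 'M[R]_r :=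
  \matrix_(i, j) K (X i) (X j).

End Kernels.

Section Cubes.
Context {R : realType} (p N : nat) (X : 'I_N -> 'rV[R]_3).

(* [k : cube_index j] stands for the dyadic cube
   prod_t [k_t / 2^j, (k_t + 1) / 2^j]. *)
Definition cube_index (j : nat) := {ffun 'I_3 -> 'I_(2 ^ j)}.

Definition in_cube (j : nat) (k : cube_index j) (x : 'rV[R]_3) : Prop :=
  forall t, (k t)%:R / 2 ^+ j <= x 0 t <= (k t).+1%:R / 2 ^+ j.

Definition subcube (j : nat) (k : cube_index j) (l : cube_index j.+1) : bool :=
  [forall t, (l t)./2 == k t :> nat].

(* The closed subcubes overlap on their faces. [cell j i] is the one cube of
   level [j] to which node [i] is assigned: the choice on shared faces is
   arbitrary, and only the values at cubes of the tree matter (an assignment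
   can always be continued below a cube that is not subdivided). *)
Definition node_assignment (cell : forall j, 'I_N -> cube_index j) : Prop :=
  (forall j i, in_cube (cell j i) (X i)) /\
  (forall j i, subcube (cell j i) (cell j.+1 i)).

Variable cell : forall j, 'I_N -> cube_index j.

Definition nodes (j : nat) (k : cube_index j) : {set 'I_N} :=
  [set i | cell j i == k].

Fixpoint cubes (j : nat) : {set cube_index j} :=
  match j return {set cube_index j} with
  | 0 => [set k | nodes k != set0]
  | j'.+1 => [set l | (nodes l != set0) &&
      [exists k in cubes j', (Mdim p < #|nodes k|)%N && subcube k l]]
  end.

Definition largest_level (n : nat) : Prop :=
  cubes n != set0 /\ forall j, cubes j != set0 -> (j <= n)%N.

Definition children (j : nat) (k : cube_index j) : {set cube_index j.+1} :=
  [set l in cubes j.+1 | subcube k l].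

End Cubes.

Definition root_cube : cube_index 0 := [ffun => ord0].

Section Basis.
Context {R : realType} (N : nat) (X : 'I_N -> 'rV[R]_3).

(* Finite families of vectors of R^N are sequences; every condition below is
   insensitive to their order. *)
Definition colsmx (vs : seq 'cV[R]_N) : 'M[R]_(N, size vs) :=
  \matrix_(i, j) vs`_j i 0.

(* [G] has the orthonormal basis g_1, ..., g_s as its columns (numbered from
   0), of which those from [a] on span the null space of [Q^T V]. *)
Definition decomposition (d : nat) (q : 'I_(Mdim d) -> {mpoly R[3]})
    (vs avg det : seq 'cV[R]_N) : Prop :=
  let V := colsmx vs in
  let A := (polymx X q)^T *m V in
  let a : nat := \rank A in
  exists G : 'M[R]_(size vs),
    [/\ G^T *m G = 1%:M,
        basis_of (lker (linfun (mulmx A : 'cV_(size vs) -> 'cV_(Mdim d))))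
          [seq col l G | l : 'I_(size vs) <- enum 'I_(size vs) & (a <= l)%N],
        avg = [seq V *m col l G | l : 'I_(size vs) <- enum 'I_(size vs) & (l < a)%N]
      & det = [seq V *m col l G | l : 'I_(size vs) <- enum 'I_(size vs) & (a <= l)%N]].

Variables (p m : nat) (q : forall d, 'I_(Mdim d) -> {mpoly R[3]}).
Variable cell : forall j, 'I_N -> cube_index j.

Definition cube_vectors (C : forall j, cube_index j -> seq 'cV[R]_N)
    (j : nat) (k : cube_index j) : seq 'cV[R]_N :=
  if children p cell k == set0
  then [seq delta_mx i 0 | i <- enum (nodes cell k)]
  else \big[cat/[::]]_(l in children p cell k) C j.+1 l.

(* [C j k], [D j k] are the average and detail vectors of cube [k] at level
   [j]; [Cc], [Dc] those of the additional coarse level -1. *)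
Definition adapted_hb (C D : forall j, cube_index j -> seq 'cV[R]_N)
    (Cc Dc : seq 'cV[R]_N) : Prop :=
  (forall j k, k \in cubes p cell j ->
     decomposition (@q p) (cube_vectors C k) (C j k) (D j k)) /\
  decomposition (@q m) (C 0%N root_cube) Cc Dc.

Definition all_details (D : forall j, cube_index j -> seq 'cV[R]_N)
    (n : nat) : seq 'cV[R]_N :=
  \big[cat/[::]]_(0 <= j < n.+1) \big[cat/[::]]_(k in cubes p cell j) D j k.

Definition columns_of (r : nat) (A : 'M[R]_(N, r)) (vs : seq 'cV[R]_N) : Prop :=
  perm_eq [seq col j A | j <- enum 'I_r] vs.

End Basis.

Definition rbf_solution {R : realType} (N m : nat) (K : 'M[R]_N)
    (Q : 'M[R]_(N, Mdim m)) (d u : 'cV[R]_N) (c : 'cV[R]_(Mdim m)) : Prop :=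
  block_mx K Q Q^T 0 *m col_mx u c = col_mx d 0.

(* Main.v *)
Require Import Defs.
From mathcomp Require Import all_boot all_order all_algebra.
From mathcomp Require Import reals.
From mathcomp Require Import mpoly.
From mathcomp Require Import zify.

(** The adapted hierarchical basis is an orthonormal basis of R^N. Indeed each
    decomposition multiplies a family of orthonormal vectors by an orthogonal
    matrix, so inside an orthonormal basis of R^N it replaces one block by
    another orthonormal block of the same size and span. Starting from the
    standard basis, grouped by the cubes of the tree, and working from the
    finest level to the root (orthonormal_basis_inputs), one reaches the basis
    made of the average vectors of the root cube and all the detail vectors;
    the coarse decomposition then splits the averages into [Cc] and [Dc].

    Detail vectors of degree p are orthogonal to P^p(X), hence to P^m(X), and
    those of the coarse decomposition are orthogonal to P^m(X). Vectors of an
    orthonormal basis that are killed by Q^T do not matter for the rank of Q^T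
    (rank_kept_vectors), and that rank is the dimension of the polynomial space
    (dim_polyspace). So the root cube has M = dim P^p(X) average vectors, the
    coarse level has O = dim P^m(X) of them, and this leaves M - O columns for
    Cperp and N - M for T.

    Finally [u = Cc Cc^T u + Cperp Cperp^T u + T T^T u], and Q^T u = 0 forces
    Q^T Cc (Cc^T u) = 0. As Q^T Cc has full column rank O, the first term
    disappears, and s = Cperp^T u and w = T^T u represent u. Multiplying
    K u + Q c = d by Cperp^T and T^T eliminates c and gives the reduced
    system. *)

Set Implicit Arguments.
Unset Strict Implicit.
Unset Printing Implicit Defensive.

Import Order.TTheory GRing.Theory Num.Theory.
Local Open Scope ring_scope.

(** * Orthonormal families given as sequences *)

Section Orthonormal.
Context {R : realType} {N : nat}.
Implicit Types (v w : 'cV[R]_N) (vs ws rs : seq 'cV[R]_N).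

(** Phrased through membership rather than positions, so that it is visibly
    invariant under permutation. *)
Definition orthonormal vs : Prop :=
  uniq vs /\ {in vs &, forall v w, v^T *m w = (v == w)%:R%:M}.

Definition columns r (A : 'M[R]_(N, r)) : seq 'cV[R]_N :=
  [seq col j A | j <- enum 'I_r].

Lemma size_columns r (A : 'M[R]_(N, r)) : size (columns A) = r.
Proof. by rewrite size_map size_enum_ord. Qed.

Lemma mem_columns r (A : 'M[R]_(N, r)) j : col j A \in columns A.
Proof. by apply/mapP; exists j; rewrite ?mem_enum. Qed.

Lemma columns_colsmx vs : columns (colsmx vs) = vs.
Proof.
apply: (@eq_from_nth _ 0) => [|i]; rewrite size_columns // => lt_i.
rewrite (nth_map (Ordinal lt_i)) ?size_enum_ord //.
by apply/colP => k; rewrite !mxE nth_enum_ord.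
Qed.

Lemma mulmx_columns r k (B : 'M[R]_(k, N)) (A : 'M[R]_(N, r)) :
  (forall v, v \in columns A -> B *m v = 0) -> B *m A = 0.
Proof.
move=> BA0; apply/matrixP => i j.
have /colP/(_ i) := BA0 _ (mem_columns A j).
by rewrite !mxE => {2}<-; apply: eq_bigr => l _; rewrite mxE.
Qed.

Lemma sum_columns r (A : 'M[R]_(N, r)) :
  \sum_(v <- columns A) v *m v^T = A *m A^T.
Proof.
rewrite big_map big_enum /=; apply/matrixP => i j.
rewrite summxE mxE; apply: eq_bigr => l _.
by rewrite !mxE big_ord1 !mxE.
Qed.

Lemma orthonormal_columns r (A : 'M[R]_(N, r)) :
  orthonormal (columns A) <-> A^T *m A = 1%:M.
Proof.
have gramE i j : (col i A)^T *m col j A = ((A^T *m A) i j)%:M.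
  apply/matrixP => a b; rewrite !ord1 !mxE eqxx mulr1n.
  by apply: eq_bigr => k _; rewrite !mxE.
split=> [[unA onA] | AA1].
  apply/matrixP => i j.
  have := onA (col i A) (col j A).
  rewrite !mem_columns gramE => /(_ isT isT)/matrixP/(_ 0 0).
  rewrite [LHS]mxE [RHS]mxE /= !mulr1n => ->; rewrite [RHS]mxE.
  have /injectiveP col_inj : injectiveb (fun j => col j A) by [].
  by rewrite (inj_eq col_inj).
have col_inj : injective (fun j => col j A).
  move=> i j eq_ij; have := gramE i j; rewrite -eq_ij gramE AA1.
  move=> /matrixP/(_ 0 0); rewrite !mxE !eqxx /= => /eqP.
  by case: (eqVneq i j) => // _; rewrite !mulr1n oner_eq0.
split; first by rewrite map_inj_uniq ?enum_uniq.
move=> _ _ /mapP[i _ ->] /mapP[j _ ->]; rewrite gramE AA1 mxE.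
by rewrite (inj_eq col_inj).
Qed.

Lemma perm_orthonormal vs ws :
  perm_eq vs ws -> orthonormal vs -> orthonormal ws.
Proof.
move=> eq_vw [un_v on_v]; split; first by rewrite -(perm_uniq eq_vw).
by move=> v w; rewrite -!(perm_mem eq_vw); apply: on_v.
Qed.

(** Mutually orthogonal families of unit vectors are disjoint, whence a
    duplicate-free concatenation. *)
Lemma orthonormal_cat vs ws :
  orthonormal (vs ++ ws) <->
  [/\ orthonormal vs, orthonormal ws
    & {in vs & ws, forall v w, v^T *m w = 0}].
Proof.
split=> [[un_vw on_vw] | [[un_v on_v] [un_w on_w] ort]].
  have:= un_vw; rewrite cat_uniq => /and3P[un_v disj un_w]; split.
  - split=> // v w v_in w_in.
    by apply: on_vw; rewrite mem_cat ?v_in ?w_in.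
  - split=> // v w v_in w_in.
    by apply: on_vw; rewrite mem_cat ?v_in ?w_in orbT.
  move=> v w v_in w_in.
  rewrite on_vw ?mem_cat ?v_in ?w_in ?orbT //.
  case: eqP => [eq_vw|_]; last by rewrite raddf0.
  by case/hasP: disj; exists w; rewrite // -eq_vw.
have disj : forall v, v \in vs -> v \in ws -> False.
  move=> v v_in v_in'; have := on_v v v v_in v_in.
  rewrite ort // eqxx => /matrixP/(_ 0 0)/eqP.
  by rewrite !mxE /= eq_sym oner_eq0.
have neq v w : v \in vs -> w \in ws -> (v == w) = false.
  by move=> v_in w_in; apply/eqP => eq_vw; apply: (disj v); rewrite // eq_vw.
split.
  rewrite cat_uniq un_v un_w andbT; apply/hasPn => v v_in.
  by apply/negP => /disj; apply.
move=> v w; rewrite !mem_cat => /orP[v_in|v_in] /orP[w_in|w_in].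
- exact: on_v.
- by rewrite ort // neq // raddf0.
- by rewrite -[LHS]trmxK trmx_mul trmxK ort // eq_sym neq // trmx0 raddf0.
- exact: on_w.
Qed.

(** A left inverse of a square matrix is a right inverse, so a full
    orthonormal family resolves the identity. *)
Lemma parseval vs :
  orthonormal vs -> size vs = N -> \sum_(v <- vs) v *m v^T = 1%:M.
Proof.
move=> on_vs size_vs; rewrite -{1}(columns_colsmx vs) sum_columns.
move: on_vs; rewrite -{1}(columns_colsmx vs) => /orthonormal_columns.
move: (colsmx vs); rewrite size_vs => A; exact: mulmx1C.
Qed.

(** Since [B = \sum_v B v v^T] over the whole basis, and the terms in [ws]
    vanish, [B] factors through [B *m colsmx vs]. With [B = Q^T] this shows
    that vectors orthogonal to the polynomials can be set aside without
    changing the number of average vectors of the next decomposition. *)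
Lemma rank_kept_vectors k (B : 'M[R]_(k, N)) vs ws :
  orthonormal (vs ++ ws) -> size (vs ++ ws) = N ->
  (forall w, w \in ws -> B *m w = 0) ->
  \rank (B *m colsmx vs) = \rank B.
Proof.
move=> on_vw size_vw Bw0; apply/eqP; rewrite eqn_leq mxrankM_maxl /=.
have {1}-> : B = B *m colsmx vs *m (colsmx vs)^T.
  rewrite -mulmxA -sum_columns columns_colsmx.
  rewrite -[LHS]mulmx1 -(parseval on_vw size_vw) big_cat /= mulmxDr.
  have -> : B *m (\sum_(w <- ws) w *m w^T) = 0; last by rewrite addr0.
  rewrite mulmx_sumr big_seq big1 // => w w_in.
  by rewrite mulmxA Bw0 // mul0mx.
exact: mxrankM_maxl.
Qed.

End Orthonormal.

(** * Polynomial spaces on the nodes *)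

Section PolynomialSpaces.
Context {R : realType} {N : nat}.

(** The transposed rows of a row base of [A] form a basis of [U]. *)
Lemma dim_eq_rank k (U : {vspace 'cV[R]_N}) (A : 'M[R]_(k, N)) :
  (forall v, v \in U <-> (v^T <= A)%MS) -> \dim U = \rank A.
Proof.
move=> memU; pose t := [tuple (row i (row_base A))^T | i < \rank A].
have tE (i : 'I_(\rank A)) : t`_i = (row i (row_base A))^T :> 'cV_N.
  by rewrite -tnth_nth tnth_mktuple.
have sumE (y : 'I_(\rank A) -> R) :
    \sum_i y i *: t`_i = ((\row_i y i) *m row_base A)^T.
  rewrite mulmx_sum_row raddf_sum; apply: eq_bigr => i _.
  by rewrite tE; apply/colP => j; rewrite !mxE.
have free_t : free t.
  apply/freeP => y; rewrite sumE => /eqP; rewrite trmx_eq0.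
  rewrite mulmx_free_eq0 ?row_base_free // => /eqP/rowP y0 i.
  by have := y0 i; rewrite !mxE.
have span_t : <<t>>%VS = U.
  apply/vspaceP => v; apply/idP/idP => [/coord_span ->|].
    by rewrite sumE; apply/memU; rewrite trmxK -(eq_row_base A) submxMl.
  move/memU; rewrite -(eq_row_base A) => /submxP[y vE].
  have -> : v = \sum_i y 0 i *: t`_i.
    rewrite sumE -[v]trmxK vE; congr (_ *m _)^T.
    by apply/rowP => i; rewrite mxE.
  by apply: rpred_sum => i _; apply: rpredZ; apply/memv_span/mem_nth; rewrite size_tuple.
by rewrite -span_t (eqP free_t) size_tuple.
Qed.

Context (X : 'I_N -> 'rV[R]_3) (q : forall d, 'I_(Mdim d) -> {mpoly R[3]}).
Hypothesis q_basis : forall d, poly_basis (@q d).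

Lemma evalv_comb d (c : 'I_(Mdim d) -> R) :
  evalv X (\sum_l c l *: q l) = polymx X (@q d) *m \col_l c l.
Proof.
apply/colP => i; rewrite !mxE raddf_sum /=; apply: eq_bigr => l _.
by rewrite !mxE mevalZ mulrC.
Qed.

Lemma dim_polyspace d : \dim (polyspace d X) = \rank (polymx X (@q d))^T.
Proof.
have [deg_q _ span_q] := q_basis d.
apply: dim_eq_rank => v; rewrite polyspaceP; split=> [[f df ->]|].
  have [c ->] := span_q f df; rewrite evalv_comb trmx_mul; exact: submxMl.
case/submxP => y vE; exists (\sum_l y 0 l *: q l).
  elim/big_rec: _ => [|l f _ df]; first by rewrite /tdeg_le msize0.
  apply: leq_trans (msizeD_le _ _) _; rewrite geq_max; apply/andP; split=> //.
  exact: leq_trans (msizeZ_le _ _) (deg_q l).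
rewrite evalv_comb -[v]trmxK vE trmx_mul trmxK; congr (_ *m _).
by apply/colP => l; rewrite !mxE.
Qed.

(** Each basis polynomial of degree at most [m] expands in the basis for
    degree [p]; the coefficients are the entries of [B]. *)
Lemma polymx_factor m p : (m <= p)%N ->
  exists B, polymx X (@q m) = polymx X (@q p) *m B.
Proof.
move=> le_mp; have [deg_m _ _] := q_basis m; have [_ _ span_p] := q_basis p.
have ex_c l : exists c : 'I_(Mdim p) -> R,
    q (l : 'I_(Mdim m)) = \sum_k c k *: q k.
  by apply: span_p; apply: leq_trans (deg_m l) _; rewrite ltnS.
have [c qE] := fin_all_exists ex_c.
exists (\matrix_(k, l) c l k); apply/matrixP => i l.
have /colP/(_ i) := evalv_comb (c l); rewrite -qE !mxE => ->.
by apply: eq_bigr => k _; rewrite !mxE.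
Qed.

Lemma annihilate_lower_degree m p (v : 'cV[R]_N) : (m <= p)%N ->
  (polymx X (@q p))^T *m v = 0 -> (polymx X (@q m))^T *m v = 0.
Proof.
move=> /polymx_factor[B ->] v0.
by rewrite trmx_mul -mulmxA v0 mulmx0.
Qed.

(** * The decomposition into average and detail vectors *)

Section Decomposition.
Variables (d : nat) (qd : 'I_(Mdim d) -> {mpoly R[3]}).
Variables (vs avg det : seq 'cV[R]_N).
Hypothesis dec : decomposition X qd vs avg det.

(** The vectors [V g_l] are the columns of [V G], and [V G] has the Gram
    matrix of [V] when [G] is orthogonal. *)
Lemma decomposition_columns : exists2 G : 'M[R]_(size vs),
  G^T *m G = 1%:M & perm_eq (avg ++ det) (columns (colsmx vs *m G)).
Proof.
case: dec => G [GG _ -> ->]; exists G => //.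
set a := \rank _.
have -> : columns (colsmx vs *m G) =
    [seq colsmx vs *m col l G | l <- enum 'I_(size vs)].
  by apply: eq_map => l; rewrite !colE mulmxA.
rewrite -map_cat; apply: perm_map.
have /permPl := perm_filterC (fun l : 'I_(size vs) => (l < a)%N) (enum 'I__).
rewrite (@eq_filter _ (predC _) (fun l : 'I_(size vs) => (a <= l)%N)) // => l.
by rewrite /= -leqNgt.
Qed.

Lemma size_decomposition : size (avg ++ det) = size vs.
Proof.
by have [G _ /perm_size->] := decomposition_columns; rewrite size_columns.
Qed.

Lemma size_average : size avg = \rank ((polymx X qd)^T *m colsmx vs).
Proof.
case: dec => G [_ _ -> _]; rewrite size_map; set a := \rank _.
rewrite size_filter -(count_map (@nat_of_ord _) (fun l => (l < a)%N)).
rewrite val_enum_ord -size_filter.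
have le_a : (a <= size vs)%N by exact: rank_leq_col.
rewrite -(subnKC le_a) iotaD filter_cat size_cat.
rewrite (@eq_in_filter _ _ predT) => [|l]; last by rewrite mem_iota.
rewrite (@eq_in_filter _ _ pred0 (iota (0 + a) _)) => [|l]; last first.
  by rewrite mem_iota add0n => /andP[/leq_gtF].
by rewrite filter_predT filter_pred0 addn0 size_iota.
Qed.

Lemma detail_annihilated v : v \in det -> (polymx X qd)^T *m v = 0.
Proof.
case: dec => G [_ bG _ ->]; case/mapP => l l_in ->; rewrite mulmxA.
have : col l G \in lker (linfun (mulmx ((polymx X qd)^T *m colsmx vs) :
    'cV_(size vs) -> 'cV_(Mdim d))).
  by apply: (basis_mem bG); apply: map_f.
by rewrite memv_ker lfunE => /eqP.
Qed.

(** Orthogonality to [ws] survives because the new vectors stay in the span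
    of [vs]. *)
Lemma orthonormal_decomposition ws :
  orthonormal (vs ++ ws) -> orthonormal (avg ++ det ++ ws).
Proof.
have [G GG ad_perm] := decomposition_columns.
rewrite catA => /orthonormal_cat[on_v on_w ort].
have eq_ad := perm_cat ad_perm (perm_refl ws).
rewrite perm_sym in eq_ad; apply: (perm_orthonormal eq_ad).
apply/orthonormal_cat; split=> //.
  rewrite orthonormal_columns trmx_mul -mulmxA (mulmxA _^T (colsmx vs)).
  move: on_v; rewrite -{1}(columns_colsmx vs) => /orthonormal_columns ->.
  by rewrite mul1mx.
move=> _ w /mapP[l _ ->] w_in.
have wV : w^T *m colsmx vs = 0.
  apply: mulmx_columns => v; rewrite columns_colsmx => v_in.
  by rewrite -[LHS]trmxK trmx_mul trmxK ort // trmx0.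
have Vw : (colsmx vs)^T *m w = 0 by rewrite -[w]trmxK -trmx_mul wV trmx0.
by rewrite colE -mulmxA trmx_mul -mulmxA Vw mulmx0.
Qed.

End Decomposition.
End PolynomialSpaces.

(** * The tree of cubes *)

(** Concatenation is not commutative but counting turns it into addition,
    which lets families indexed by cubes be regrouped freely. *)
Lemma count_bigcat (T I : Type) (a : pred T) (r : seq I) (P : pred I)
    (F : I -> seq T) :
  count a (\big[cat/[::]]_(i <- r | P i) F i) = \sum_(i <- r | P i) count a (F i).
Proof. by apply: (big_morph (count a)) => // s t; rewrite count_cat. Qed.

Lemma parent_subproof j (l : cube_index j.+1) t : ((l t)./2 < 2 ^ j)%N.
Proof. by rewrite ltn_half_double -mul2n -expnS. Qed.

Definition parent j (l : cube_index j.+1) : cube_index j :=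
  [ffun t => Ordinal (parent_subproof l t)].

Lemma subcubeE j (k : cube_index j) (l : cube_index j.+1) :
  subcube k l = (parent l == k).
Proof.
apply/forallP/eqP => [kl | <- t]; last by rewrite ffunE.
by apply/ffunP => t; apply/val_inj; rewrite ffunE /=; apply/eqP.
Qed.

Section Tree.
Variables (p N : nat) (cell : forall j, 'I_N -> cube_index j).
Hypothesis cell_nested : forall j i, subcube (cell j i) (cell j.+1 i).

Local Notation cubes := (cubes p cell).
Local Notation children := (children p cell).
Local Notation nodes := (nodes cell).

Lemma parent_cell j i : parent (cell j.+1 i) = cell j i.
Proof. by apply/eqP; rewrite -subcubeE. Qed.

Lemma nodes_cubes j (k : cube_index j) : k \in cubes j -> nodes k != set0.
Proof. by case: j k => [|j] k; rewrite inE // => /andP[]. Qed.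

Lemma childrenE j (k : cube_index j) l :
  (l \in children k) = (l \in cubes j.+1) && (parent l == k).
Proof. by rewrite in_set subcubeE. Qed.

Lemma parent_cubes j (l : cube_index j.+1) :
  l \in cubes j.+1 -> parent l \in cubes j /\ children (parent l) != set0.
Proof.
move=> l_in; have := l_in; rewrite inE => /andP[_ /exists_inP[k k_in]].
rewrite subcubeE => /andP[_ /eqP lk]; rewrite lk; split=> //.
by apply/set0Pn; exists l; rewrite childrenE l_in lk eqxx.
Qed.

(** A cube with one child has been subdivided, and then every subcube that
    holds a node is a child; so the children of a cube cover all its nodes. *)
Lemma cell_children j (k : cube_index j) i :
  k \in cubes j -> children k != set0 -> i \in nodes k ->
  cell j.+1 i \in children k.
Proof.
move=> k_in /set0Pn[l]; rewrite childrenE => /andP[l_in /eqP lk].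
rewrite inE => /eqP ik; rewrite childrenE parent_cell ik eqxx andbT inE.
apply/andP; split; first by apply/set0Pn; exists i; rewrite inE.
apply/exists_inP; exists k; rewrite // subcubeE parent_cell ik eqxx andbT.
move: l_in; rewrite inE => /andP[_ /exists_inP[k' _]].
by rewrite subcubeE lk => /andP[big_k' /eqP ->].
Qed.

(** Families of vectors are compared up to permutation by counting, so facts
    about the tree are needed as identities between sums over [nat]. *)
Lemma sum_nodes_children j (k : cube_index j) (F : 'I_N -> nat) :
  k \in cubes j -> children k != set0 ->
  \sum_(i in nodes k) F i = \sum_(l in children k) \sum_(i in nodes l) F i.
Proof.
move=> k_in k_par.
rewrite (partition_big (@cell j.+1) (fun l => l \in children k)) => [|i]; last first.
  exact: cell_children.
apply: eq_bigr => l; rewrite childrenE => /andP[_ /eqP lk].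
apply: eq_bigl => i; rewrite !inE andbC; case: eqP => //= il.
by rewrite -parent_cell il lk eqxx.
Qed.

Lemma sum_children j (G : cube_index j.+1 -> nat) :
  \sum_(k in cubes j | children k != set0) \sum_(l in children k) G l =
  \sum_(l in cubes j.+1) G l.
Proof.
rewrite [RHS](partition_big (@parent j)
    (fun k => (k \in cubes j) && (children k != set0))) => [|l]; last first.
  by case/parent_cubes => -> ->.
by apply: eq_bigr => k _; apply: eq_bigl => l; rewrite childrenE.
Qed.

(** The cubes of level [j], together with the childless cubes at coarser
    levels, form a partition of the nodes. *)
Lemma sum_nodes_cut j (F : 'I_N -> nat) :
  (\sum_(k in cubes j) \sum_(i in nodes k) F i +
   \sum_(0 <= i < j) \sum_(k in cubes i | children k == set0)
      \sum_(t in nodes k) F t = \sum_i F i)%N.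
Proof.
elim: j => [|j IHj].
  rewrite big_geq // addn0.
  rewrite [RHS](partition_big (@cell 0) (fun k => k \in cubes 0)) => [|i _].
    by apply: eq_bigr => k _; apply: eq_bigl => i; rewrite inE.
  by rewrite !inE; apply/set0Pn; exists i; rewrite inE.
rewrite -{}[RHS]IHj big_nat_recr //= [in LHS]addnA [in LHS]addnAC.
congr addn; rewrite [RHS](bigID (fun k => children k == set0)) /= addnC.
congr addn; rewrite -sum_children.
by apply: eq_bigr => k /andP[k_in k_par]; rewrite sum_nodes_children.
Qed.

End Tree.

(** * The adapted basis is an orthonormal basis *)

Section AdaptedBasis.
Context {R : realType} {N : nat}.
Implicit Types (vs ws : seq 'cV[R]_N).

Definition orthonormal_basis vs : Prop := orthonormal vs /\ size vs = N.

Lemma perm_orthonormal_basis vs ws :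
  perm_eq vs ws -> orthonormal_basis vs -> orthonormal_basis ws.
Proof.
move=> eq_vw [on_v size_v]; split; first exact: perm_orthonormal on_v.
by rewrite -(perm_size eq_vw).
Qed.

Definition unit_vectors (A : {set 'I_N}) : seq 'cV[R]_N :=
  [seq delta_mx i 0 | i <- enum A].

Lemma orthonormal_basis_units : orthonormal_basis (unit_vectors setT).
Proof.
have -> : unit_vectors setT = columns 1%:M.
  rewrite /unit_vectors enum_setT -enumT.
  by apply: eq_map => i; rewrite colE mul1mx.
split; last exact: size_columns.
by apply/orthonormal_columns; rewrite trmx1 mul1mx.
Qed.

Lemma count_unit_vectors a (A : {set 'I_N}) :
  count a (unit_vectors A) = \sum_(i in A) (a (delta_mx i 0) : nat).
Proof. by rewrite count_map -sum1_count big_enum_cond big_mkcondr. Qed.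

Context (X : 'I_N -> 'rV[R]_3).

Lemma orthonormal_basis_decomposition d (q : 'I_(Mdim d) -> {mpoly R[3]})
    vs avg det ws :
  decomposition X q vs avg det -> orthonormal_basis (vs ++ ws) ->
  orthonormal_basis (avg ++ det ++ ws).
Proof.
move=> dec [on_v size_v]; split; first exact (orthonormal_decomposition dec on_v).
by rewrite catA size_cat (size_decomposition dec) -size_cat.
Qed.

(** The blocks are treated one at a time, each against the others. *)
Lemma orthonormal_basis_decompositions d (q : 'I_(Mdim d) -> {mpoly R[3]})
    (I : Type) (r : seq I) (P : pred I) (V A D : I -> seq 'cV[R]_N) ws :
  (forall k, P k -> decomposition X q (V k) (A k) (D k)) ->
  orthonormal_basis (\big[cat/[::]]_(k <- r | P k) V k ++ ws) ->
  orthonormal_basis (\big[cat/[::]]_(k <- r | P k) A k ++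
                     \big[cat/[::]]_(k <- r | P k) D k ++ ws).
Proof.
move=> dec; elim: r ws => [|k r IHr] ws; first by rewrite !big_nil.
rewrite !big_cons; case: ifP => [Pk|_]; last exact: IHr.
rewrite -catA => /(orthonormal_basis_decomposition (dec k Pk)) onb.
apply: perm_orthonormal_basis (IHr (A k ++ D k ++ ws) _).
  by apply/permP => a; rewrite !count_cat; lia.
apply: perm_orthonormal_basis onb.
by apply/permP => a; rewrite !count_cat; lia.
Qed.

Variables (p m : nat) (q : forall d, 'I_(Mdim d) -> {mpoly R[3]}).
Variable cell : forall j, 'I_N -> cube_index j.
Hypothesis cell_nested : forall j i, subcube (cell j i) (cell j.+1 i).
Variable n : nat.
Hypothesis hn : largest_level p cell n.
Variables C D : forall j, cube_index j -> seq 'cV[R]_N.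
Hypothesis dec : forall j (k : cube_index j), k \in cubes p cell j ->
  decomposition X (@q p) (cube_vectors p cell C k) (C k) (D k).

Definition leaf_vectors j : seq 'cV[R]_N :=
  \big[cat/[::]]_(0 <= i < j)
    \big[cat/[::]]_(k in cubes p cell i | children p cell k == set0)
      unit_vectors (nodes cell k).

Definition details_from j : seq 'cV[R]_N :=
  \big[cat/[::]]_(j <= i < n.+1) \big[cat/[::]]_(k in cubes p cell i) D k.

(** Around the decompositions of level [j], the current basis of R^N consists
    of the families being decomposed (or their average vectors), the unit
    vectors of nodes in leaf cubes of coarser levels, which have not entered
    any decomposition yet, and the detail vectors already split off. *)
Definition level_inputs j : seq 'cV[R]_N :=
  \big[cat/[::]]_(k in cubes p cell j) cube_vectors p cell C k
  ++ leaf_vectors j ++ details_from j.+1.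

Definition level_outputs j : seq 'cV[R]_N :=
  \big[cat/[::]]_(k in cubes p cell j) C k ++ leaf_vectors j ++ details_from j.

Lemma cubes_above : cubes p cell n.+1 = set0.
Proof. by apply/eqP/negPn/negP => /hn.2; rewrite ltnn. Qed.

Lemma perm_leaf_vectors : perm_eq (leaf_vectors n.+1) (unit_vectors setT).
Proof.
apply/permP => a; rewrite count_unit_vectors.
under [RHS]eq_bigl do rewrite inE.
rewrite -(sum_nodes_cut p cell_nested n.+1) cubes_above big_set0 add0n.
rewrite count_bigcat; apply: eq_bigr => i _.
by rewrite count_bigcat; apply: eq_bigr => k _; rewrite count_unit_vectors.
Qed.

(** Going up one level only regroups vectors: the averages of level [j.+1] are
    collected cube by cube under their parents, and the leaves of level [j]
    contribute their unit vectors. *)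
Lemma perm_level_outputs j : perm_eq (level_outputs j.+1) (level_inputs j).
Proof.
apply/permP => a; rewrite !count_cat !addnA; congr addn.
rewrite {1}/leaf_vectors big_nat_recr //= -/(leaf_vectors j) count_cat.
rewrite addnCA addnC; congr addn.
rewrite !count_bigcat -sum_children [RHS](bigID (fun k => children p cell k == set0)).
rewrite /= addnC; congr addn; apply: eq_bigr => k /andP[_ k_leaf].
  by rewrite /cube_vectors k_leaf.
by rewrite /cube_vectors (negPf k_leaf) count_bigcat.
Qed.

Lemma orthonormal_basis_outputs j :
  (j <= n)%N -> orthonormal_basis (level_inputs j) ->
  orthonormal_basis (level_outputs j).
Proof.
move=> le_jn /(orthonormal_basis_decompositions (@dec j)) onb.
apply: perm_orthonormal_basis onb.
rewrite /level_outputs perm_cat2l perm_catCA perm_cat2l.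
by rewrite /details_from (@big_ltn _ _ _ j).
Qed.

(** Downward induction on the level. Beyond the last level there are no cubes
    and the basis consists of all the unit vectors; from then on each
    decomposition replaces a block of the basis by an orthonormal family of
    the same size and span. *)
Lemma orthonormal_basis_inputs j :
  (j <= n)%N -> orthonormal_basis (level_inputs j).
Proof.
move=> le_jn; apply: perm_orthonormal_basis (perm_level_outputs j) _.
have out k : (k <= n.+1)%N -> orthonormal_basis (level_outputs (n.+1 - k)).
  elim: k => [_|k IHk lt_kn].
    rewrite subn0 /level_outputs cubes_above big_set0 cat0s.
    rewrite /details_from big_geq // cats0.
    apply: perm_orthonormal_basis orthonormal_basis_units.
    by rewrite perm_sym perm_leaf_vectors.
  apply: orthonormal_basis_outputs; first by rewrite subSS leq_subr.
  apply: perm_orthonormal_basis (perm_level_outputs _) _.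
  by rewrite subnSK //; apply/IHk/ltnW.
by rewrite -(subKn (_ : j < n.+1)%N) //; apply/out/leq_subr.
Qed.

Lemma cubes_root : cubes p cell 0 = [set root_cube].
Proof.
apply/setP => k; rewrite !inE.
have all_root (k' : cube_index 0) : k' = root_cube.
  by apply/ffunP => t; rewrite !(ord1 (_ : 'I_1)).
rewrite [k]all_root eqxx; have /set0Pn[l l_in] := hn.1.
have /set0Pn[i _] := nodes_cubes l_in.
by apply/set0Pn; exists i; rewrite inE [cell 0 i]all_root.
Qed.

Lemma orthonormal_basis_root :
  orthonormal_basis (cube_vectors p cell C root_cube ++ details_from 1).
Proof.
have := orthonormal_basis_inputs (leq0n n).
by rewrite /level_inputs cubes_root big_set1 /leaf_vectors big_geq.
Qed.

Lemma details_from0 :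
  all_details p cell D n = D root_cube ++ details_from 1.
Proof. by rewrite /all_details big_ltn // cubes_root big_set1. Qed.

Lemma details_annihilated j v :
  v \in details_from j -> (polymx X (@q p))^T *m v = 0.
Proof.
rewrite /details_from; elim/big_rec: _ => [//|i vs _ IHvs].
rewrite mem_cat => /orP[|//]; elim/big_rec: _ => [//|k ws k_in IHws].
by rewrite mem_cat => /orP[v_in|//]; exact (detail_annihilated (dec k_in) v_in).
Qed.

End AdaptedBasis.

(** * The reduced interpolation system *)

Theorem theorem2 (R : realType) (p m N : nat) (hmp : (m <= p)%N)
    (X : 'I_N -> 'rV[R]_3) (X_inj : injective X)
    (X_cube : forall i t, 0 <= X i 0 t <= 1)
    (X_unisolvent : unisolvent p X)
    (q : forall d, 'I_(Mdim d) -> {mpoly R[3]})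
    (q_basis : forall d, poly_basis (@q d))
    (K : 'rV[R]_3 -> 'rV[R]_3 -> R) (hK : scpd m K \/ scnd m K)
    (d u : 'cV[R]_N)
    (u_orth : orthogonal_to u (polyspace m X))
    (u_sol : exists c : 'cV[R]_(Mdim m),
       rbf_solution (kermatrix K X) (polymx X (@q m)) d u c /\
       forall u' c',
         rbf_solution (kermatrix K X) (polymx X (@q m)) d u' c' ->
         u' = u /\ c' = c)
    (cell : forall j, 'I_N -> cube_index j)
    (hcell : node_assignment X cell)
    (n : nat) (hn : largest_level p cell n)
    (C D : forall j, cube_index j -> seq 'cV[R]_N) (Cc Dc : seq 'cV[R]_N)
    (hb : adapted_hb X p m q cell C D Cc Dc)
    (nT nC : nat) (T : 'M[R]_(N, nT)) (Cperp : 'M[R]_(N, nC))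
    (hT : columns_of T (all_details p cell D n))
    (hCperp : columns_of Cperp Dc) :
  let Kmx := kermatrix K X in
  let M := \dim (polyspace p X) in
  let O := \dim (polyspace m X) in
  nC = (M - O)%N /\ nT = (N - M)%N /\
  exists (s : 'cV[R]_nC) (w : 'cV[R]_nT),
    block_mx (Cperp^T *m Kmx *m Cperp) (Cperp^T *m Kmx *m T)
             (T^T *m Kmx *m Cperp) (T^T *m Kmx *m T)
      *m col_mx s w = col_mx (Cperp^T *m d) (T^T *m d) /\
    u = Cperp *m s + T *m w.
Proof.
move=> Kmx M O.
have cell_nested := hcell.2; have [dec dec_c] := hb.
set Q := fun d => polymx X (@q d).
have kill v : v \in all_details p cell D n -> (Q p)^T *m v = 0.
  exact: details_annihilated dec 0%N v.
have [on_root size_root] := orthonormal_basis_root cell_nested hn dec.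
have root_in : root_cube \in cubes p cell 0 by rewrite (cubes_root hn) inE.
have size_C0 : size (C 0%N root_cube) = M.
  rewrite (size_average (dec _ _ root_in)).
  rewrite (rank_kept_vectors on_root size_root); first by rewrite -dim_polyspace.
  exact: details_annihilated dec 1%N.
have on_fine : orthonormal_basis (C 0%N root_cube ++ all_details p cell D n).
  rewrite (details_from0 hn D).
  exact: orthonormal_basis_decomposition (dec _ _ root_in) (conj on_root size_root).
have kill_m v : v \in all_details p cell D n -> (Q m)^T *m v = 0.
  by move=> /kill; apply: annihilate_lower_degree hmp.
have size_Cc : size Cc = O.
  rewrite (size_average dec_c) (rank_kept_vectors on_fine.1 on_fine.2) //.
  by rewrite -dim_polyspace.
have [on_B size_B] := orthonormal_basis_decomposition dec_c on_fine.
have nCE : nC = size Dc by rewrite -(perm_size hCperp) size_columns.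
have nTE : nT = size (all_details p cell D n).
  by rewrite -(perm_size hT) size_columns.
have size_Dc : (O + nC)%N = M.
  by rewrite -size_Cc nCE -size_cat (size_decomposition dec_c).
have size_D : (M + nT)%N = N by rewrite -size_C0 nTE -size_cat on_fine.2.
split; first by rewrite -size_Dc addKn.
split; first by rewrite -[in RHS]size_D addKn.
have [c [sol _]] := u_sol.
move: sol; rewrite /rbf_solution mul_block_col => /eq_col_mx[].
rewrite mul0mx addr0 -/(Q m) => KuQc Qu.
have QCp : (Q m)^T *m Cperp = 0.
  apply: mulmx_columns => v; rewrite (perm_mem hCperp) => v_in.
  exact (detail_annihilated dec_c v_in).
have QT : (Q m)^T *m T = 0.
  by apply: mulmx_columns => v; rewrite (perm_mem hT); exact: kill_m.
(* Since [u] resolves along [Cc], [Cperp] and [T], only its [Cc] part has to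
   vanish; [Q^T] kills [u] and the other two parts, and is injective on the
   span of [Cc] because [Q^T Cc] has as many columns as its rank [O]. *)
have uE : u = Cperp *m (Cperp^T *m u) + T *m (T^T *m u).
  have sumE : colsmx Cc *m (colsmx Cc)^T + (Cperp *m Cperp^T + T *m T^T) = 1%:M.
    rewrite -!sum_columns columns_colsmx (perm_big _ hCperp) (perm_big _ hT) /=.
    by rewrite -!big_cat parseval.
  have uS : u = colsmx Cc *m ((colsmx Cc)^T *m u)
              + (Cperp *m (Cperp^T *m u) + T *m (T^T *m u)).
    by rewrite !mulmxA -!mulmxDl sumE mul1mx.
  suff Cu0 : (colsmx Cc)^T *m u = 0 by rewrite {1}uS Cu0 mulmx0 add0r.
  have /eqP : (Q m)^T *m colsmx Cc *m ((colsmx Cc)^T *m u) = 0.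
    by rewrite -[RHS]Qu {2}uS !mulmxDr !mulmxA QCp QT !mul0mx !addr0.
  rewrite -trmx_eq0 trmx_mul mulmx_free_eq0 ?trmx_eq0; first by move/eqP.
  rewrite /row_free mxrank_tr (rank_kept_vectors on_B size_B) => [|w].
    by rewrite -dim_polyspace // size_Cc.
  rewrite mem_cat => /orP[w_in|/kill_m//].
  exact (detail_annihilated dec_c w_in).
(* Testing [K u + Q c = d] against columns orthogonal to [P^m(X)] removes the
   unknown [c]. *)
have proj k (A : 'M[R]_(N, k)) : (Q m)^T *m A = 0 ->
    A^T *m Kmx *m Cperp *m (Cperp^T *m u) + A^T *m Kmx *m T *m (T^T *m u)
    = A^T *m d.
  move=> QA; rewrite -KuQc mulmxDr [A^T *m (Q m *m c)]mulmxA.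
  have -> : A^T *m Q m = 0 by rewrite -[Q m]trmxK -trmx_mul QA trmx0.
  by rewrite mul0mx addr0 [in RHS]uE mulmxDr mulmxDr !mulmxA.
exists (Cperp^T *m u), (T^T *m u); split=> //.
by rewrite mul_block_col !proj.
Qed.
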